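(* Let $L\in\mathbb{R}^{n\times n}$ be a given graph Laplacian, let $V=\{1,\ldots,n\}=C_1\cup C_2\cup\cdots\cup C_k$ with $C_i\cap C_j=\emptyset$ for $i\neq j$ be a prescribed partition of the vertex set into nonempty blocks, and let $\varepsilon>0$ be fixed. For each block $C_j$ let $u_j\in\mathbb{R}^n$ be its indicator vector, and define $U=[u_1,u_2,\ldots,u_k]\in\mathbb{R}^{n\times k}$. Let $M^\star$ be the unique minimizer of the problem $$ \begin{aligned} \min_{M\in\mathbb{R}^{n\times n}}\quad &\|M-L\|_F^2\\ \text{subject to}\quad & MU=0,\quad M=M^T,\quad M_{ij}\le 0\ \ (i\neq j),\\ & M_j\succeq \varepsilon P_j,\qquad j=1,\ldots,k . \end{aligned} \tag{P} $$ Then $M^\star$ is a weighted graph Laplacian whose associated graph has exactly the prescribed connected components $C_1,\ldots,C_k$. Moreover, $$\ker(M^\star)=\operatorname{span}\{u_1,u_2,\ldots,u_k\}.$$ If $k<n$, then $$\lambda_{k+1}(M^\star)\ge\varepsilon>0 .$$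
   Context: A (weighted) graph Laplacian on $V=\{1,\ldots,n\}$ is a matrix of the form $D-W$, where $W=[w_{ij}]\in\mathbb{R}^{n\times n}$ is symmetric with $w_{ij}\ge 0$ for $i\ne j$ and $w_{ii}=0$, and $D=\operatorname{diag}(d_1,\ldots,d_n)$ with $d_i=\sum_j w_{ij}$. Equivalently, it is a symmetric matrix $M$ with $M\mathbf{1}_n=0$ and $M_{ij}\le 0$ for $i\neq j$. The graph associated with a graph Laplacian $M$ is the weighted undirected graph on $V$ with edge weights $-M_{ij}$ for $i\ne j$; vertices $i\neq j$ are adjacent iff $-M_{ij}>0$. The indicator vector $u_j$ of $C_j$ has entries $(u_j)_i=1$ if $i\in C_j$ and $0$ otherwise. Put $n_j=|C_j|$; $M_j=M[C_j,C_j]\in\mathbb{R}^{n_j\times n_j}$ is the principal submatrix of $M$ indexed by $C_j$; $P_j=I_{n_j}-\frac{1}{n_j}\mathbf{1}_{n_j}\mathbf{1}_{n_j}^T$, where $\mathbf{1}_m$ is the all-ones vector in $\mathbb{R}^m$. $A\succeq B$ means that $A-B$ is positive semidefinite (for symmetric $A,B$). $\|\cdot\|_F$ is the Frobenius norm. Eigenvalues of a symmetric matrix are ordered $\lambda_1(M)\le\lambda_2(M)\le\cdots\le\lambda_n(M)$, counted with multiplicity. A singleton block is regarded as connected. *)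

(* Defs.v *)
From HB Require Import structures.
From mathcomp Require Import all_boot all_order all_algebra.
From mathcomp Require Import polyrcf reals.

Set Implicit Arguments.
Unset Strict Implicit.
Unset Printing Implicit Defensive.

Import Order.TTheory GRing.Theory Num.Theory.
Local Open Scope ring_scope.

Section Matrices.
Variable R : realType.

Definition psdmx n (A : 'M[R]_n) : Prop :=
  A^T = A /\ forall x : 'cV[R]_n, 0 <= (x^T *m A *m x) 0 0.

Definition loewner_ge n (A B : 'M[R]_n) : Prop := psdmx (A - B).

Definition frobenius m n (A : 'M[R]_(m, n)) : R :=
  Num.sqrt (\sum_i \sum_j A i j ^+ 2).

(* The real roots of the characteristic polynomial in nondecreasing order,
   each repeated according to its algebraic multiplicity; for symmetric [M]
   this list has length [n].  [rootsR] is strictly increasing. *)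
Definition eigenvalues n (M : 'M[R]_n) : seq R :=
  flatten [seq nseq (mup x (char_poly M)) x | x <- rootsR (char_poly M)].

(* Eigenvalues are numbered from 1. *)
Definition lambda n (M : 'M[R]_n) (i : nat) : R := (eigenvalues M)`_i.-1.

Definition mxker m n (M : 'M[R]_(m, n)) : {vspace 'cV[R]_n} :=
  lker (linfun (mulmx M : 'cV[R]_n -> 'cV[R]_m)).

Definition laplacian n (M : 'M[R]_n) : Prop :=
  exists W : 'M[R]_n,
    [/\ W^T = W,
        forall i j, i != j -> 0 <= W i j,
        forall i, W i i = 0
      & M = diag_mx (\row_i \sum_j W i j) - W].

Definition adj n (M : 'M[R]_n) : rel 'I_n :=
  fun i j => (i != j) && (0 < - M i j).

End Matrices.

Definition components (T : finType) (e : rel T) : {set {set T}} :=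
  equivalence_partition (connect e) [set: T].

Section Problem.
Variables (R : realType) (n k : nat) (C : 'I_k -> {set 'I_n}).

Definition block_partition : Prop :=
  [/\ forall j, C j != set0,
      forall i j, i != j -> C i :&: C j = set0
    & \bigcup_j C j = [set: 'I_n]].

Definition indvec (j : 'I_k) : 'cV[R]_n := \col_i (i \in C j)%:R.

Definition indmx : 'M[R]_(n, k) := \matrix_(i, j) indvec j i 0.

Definition blockmx (M : 'M[R]_n) (j : 'I_k) : 'M[R]_#|C j| :=
  mxsub enum_val enum_val M.

Definition ones m : 'cV[R]_m := const_mx 1.

Definition centering m : 'M[R]_m :=
  1%:M - m%:R^-1 *: (ones m *m (ones m)^T).

Definition feasible (eps : R) (M : 'M[R]_n) : Prop :=
  [/\ M *m indmx = 0,
      M = M^T,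
      forall i j, i != j -> M i j <= 0
    & forall j, loewner_ge (blockmx M j) (eps *: centering #|C j|)].

Definition minimizer (L : 'M[R]_n) (eps : R) (M : 'M[R]_n) : Prop :=
  feasible eps M /\
  forall N, feasible eps N -> frobenius (M - L) ^+ 2 <= frobenius (N - L) ^+ 2.

End Problem.

(* Main.v *)
(* The minimizer is the Frobenius projection of L onto the feasible set, which
   is closed, convex and nonempty (it contains eps times the block-diagonal
   matrix of the centering matrices).  Everything else holds for every feasible
   M.  Off-diagonal entries being nonpositive, [M u_j = 0] makes M vanish
   outside the diagonal blocks, so that [M_j >= eps P_j] bounds the sum over
   [a] in [C_j] of [x_a (M x)_a] from below by eps times the sum of the squared
   deviations of x from its mean on [C_j].  If [M x = 0], x is therefore constant
   on the blocks; applied to the indicator of a connected component this gives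
   connectedness.  An eigenvector for a nonzero eigenvalue r is orthogonal to
   every u_j, so its mean on each block is 0, and [r >= eps].  As 0 has
   multiplicity at most k, this bounds the (k+1)-st eigenvalue. *)

Require Import Defs.
From HB Require Import structures.
From mathcomp Require Import all_boot all_order all_algebra.
From mathcomp Require Import polyrcf complex spectral.
From mathcomp Require Import boolp classical_sets reals topology.
From mathcomp Require Import normedtype derive.
From mathcomp Require Import ring lra.

Set Implicit Arguments.
Unset Strict Implicit.
Unset Printing Implicit Defensive.

Import Order.TTheory GRing.Theory Num.Theory.
Import numFieldNormedType.Exports.
Local Open Scope ring_scope.

(** * Spectrum of real symmetric matrices *)

Lemma char_poly_conj (F : fieldType) n (P A : 'M[F]_n) :
  P \in unitmx -> char_poly (invmx P *m A *m P) = char_poly A.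
Proof.
move=> uP; rewrite /char_poly.
pose c := map_mx (@polyC F) : 'M[F]_n -> 'M[{poly F}]_n.
have cM B D : c (B *m D) = c B *m c D by rewrite /c map_mxM.
have cVP : c (invmx P) *m c P = 1%:M by rewrite -cM mulVmx // /c map_mx1.
(* The scalar matrix ['X] commutes with [c P], so conjugation passes through the characteristic
   matrix. *)
have -> : char_poly_mx (invmx P *m A *m P) =
    c (invmx P) *m char_poly_mx A *m c P.
  rewrite /char_poly_mx mulmxBr mulmxBl; congr (_ - _); last by rewrite -!cM.
  by rewrite -scalemx1 -scalemxAr -scalemxAl mulmx1 cVP.
by rewrite !det_mulmx mulrAC -det_mulmx cVP det1 mul1r.
Qed.

(** Each nonzero diagonal entry contributes a term of rank at most 1, and rank is subadditive. *)
Lemma mxrank_diag_le (F : fieldType) n (d : 'rV[F]_n) :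
  (\rank (diag_mx d) <= #|[pred i | (d 0 i != 0)%R]|)%N.
Proof.
rewrite diag_mx_sum_delta (bigID [pred i | d 0 i != 0]) /=.
rewrite [X in _ + X]big1 ?addr0; last first.
  by move=> i; rewrite negbK => /eqP->; rewrite scale0r.
rewrite -sum1_card; apply: (big_ind2 (fun (A : 'M_n) m => \rank A <= m)%N).
- by rewrite mxrank0.
- move=> A a B b hA hB; apply: leq_trans (mxrank_add _ _) _; exact: leq_add.
- by move=> i _; rewrite (leq_trans (mxrank_scale _ _)) // mxrank_delta.
Qed.

(* Spectral theorem over [R[i]]: the eigenvalues of the complexification are
   real, and the characteristic polynomial descends to R. *)
Lemma symmetric_char_poly_split (R : rcfType) n (A : 'M[R]_n) : A^T = A ->
  exists s : seq R, char_poly A = \prod_(x <- s) ('X - x%:P)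
    /\ (count_mem 0%R s <= \rank (kermx A))%N.
Proof.
move=> symA; pose B := map_mx (real_complex R) A.
have Bsym : B \is symmetricmx.
  by apply/is_hermitianmxP; rewrite expr0 scale1r map_mx_id // /B map_trmx symA.
have Breal : B \is a mxOver Num.real.
  by apply/mxOverP => i j; rewrite mxE; apply/complex_realP; exists (A i j).
have Bherm := realsym_hermsym Bsym Breal.
have /orthomx_spectralP := hermitian_normalmx Bherm.
have := spectral_unit B; move: (spectralmx B) => P uP.
have := hermitian_spectral_diag_real Bherm.
move: (spectral_diag B) => d /mxOverP dreal eqB.
pose r i := complex.Re (d 0 i).
have rE i : (r i)%:C%C = d 0 i by exact: RRe_real.
exists [seq r i | i : 'I_n]; split.
  (* The factorisation is checked over [R[i]], where [B] is similar to [diag_mx d], and pulled back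
     along the injective embedding. *)
  apply: (map_poly_inj (real_complex R)).
  rewrite map_char_poly -/B {1}eqB char_poly_conj // char_poly_trig; last first.
    exact: diag_mx_is_trig.
  rewrite rmorph_prod /= big_map big_enum /=; apply: eq_bigr => i _.
  by rewrite rmorphB /= map_polyX map_polyC /= rE mxE eqxx.
(* Rank is unchanged by extension of scalars and by invertible factors; transposition exposes the
   left one. *)
have rkA : \rank A = \rank (diag_mx d).
  rewrite -(mxrank_map (real_complex R)) -/B {1}eqB.
  by rewrite mxrankMfree ?row_free_unit // -mxrank_tr trmx_mul mxrankMfree
    ?mxrank_tr // row_free_unit unitmx_tr unitmx_inv.
rewrite mxrank_ker rkA count_map.
have -> : count (preim r (pred1 0)) (enum 'I_n) = #|[pred i | d 0 i == 0]|.
  rewrite -sum1_count big_enum_cond -sum1_card; apply: eq_bigl => i.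
  by rewrite !inE /= -rE (inj_eq (@complexI _) (r i) 0).
rewrite leq_subRL; last by rewrite rank_leq_row.
rewrite -[leqRHS]card_ord -(cardC [pred i | d 0 i == 0]) addnC leq_add2l.
exact: mxrank_diag_le.
Qed.

Lemma sorted_flatten_nseq (R : numDomainType) (m : R -> nat) (s : seq R) :
  sorted <%R s -> sorted <=%R (flatten [seq nseq (m x) x | x <- s]).
Proof.
rewrite !sorted_pairwise; try exact: lt_trans; try exact: le_trans.
elim: s => //= x s IHs /andP[/allP xs /IHs ps].
rewrite pairwise_cat ps andbT; apply/andP; split.
  apply/allrelP => y z /nseqP[-> _] /flatten_mapP[t /xs xt /nseqP[-> _]].
  exact: ltW.
by elim: (m x) => //= k ->; rewrite andbT; apply/allP => y /nseqP[->].
Qed.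

Lemma sorted_eigenvalues (R : realType) n (M : 'M[R]_n) :
  sorted <=%R (eigenvalues M).
Proof. exact/sorted_flatten_nseq/sorted_roots. Qed.

(** The multiplicity of a root of the product is its number of occurrences in [s], and the distinct
    roots are those of [undup s]. *)
Lemma perm_eigenvalues (R : realType) n (M : 'M[R]_n) (s : seq R) :
  char_poly M = \prod_(x <- s) ('X - x%:P) -> perm_eq (eigenvalues M) s.
Proof.
move=> eqM; rewrite /eigenvalues eqM.
have p0 : \prod_(x <- s) ('X - x%:P) != 0.
  exact/monic_neq0/monic_prod_XsubC.
apply: perm_trans (perm_count_undup s); apply: perm_flatten.
under eq_map do rewrite mu_prod_XsubC.
apply/perm_map/uniq_perm; rewrite ?undup_uniq //.
  exact: (sorted_uniq lt_trans ltxx (sorted_roots _ _ _)).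
by move=> x; rewrite mem_undup -(roots_on_rootsR p0) in_itv /= root_prod_XsubC.
Qed.

(** By contraposition: indices start at 0, so if the entry at [k] were below [e], the first [k.+1]
    entries all would be. *)
Lemma sorted_nth_ge (R : realDomainType) (e : R) (t : seq R) k :
  sorted <=%R t -> (k < size t)%N -> (count (< e) t <= k)%N -> e <= t`_k.
Proof.
move=> st kt; apply: contraTT; rewrite -ltNge -ltnNge => lt_e.
rewrite -(cat_take_drop k.+1 t) count_cat; apply: ltn_addr.
suff /eqP-> : count (< e) (take k.+1 t) == k.+1 by [].
have szt : size (take k.+1 t) = k.+1 by rewrite size_takel.
rewrite -[X in _ == X]szt -all_count; apply/(all_nthP 0) => i.
rewrite szt => ik.
rewrite nth_take // /= (le_lt_trans _ lt_e) //.
apply: (sorted_leq_nth le_trans le_refl 0 st); rewrite ?inE //.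
exact: leq_trans kt.
Qed.

(** * Quadratic forms and the labelling of blocks *)

Lemma mulmx_formE (R : comNzRingType) n (A : 'M[R]_n) (x : 'cV[R]_n) :
  (x^T *m A *m x) 0 0 = \sum_i x i 0 * \sum_j A i j * x j 0.
Proof.
by rewrite -mulmxA mxE; apply: eq_bigr => i _; rewrite !mxE.
Qed.

Lemma mulmx_formB (R : comNzRingType) n (A B : 'M[R]_n) a (x : 'cV[R]_n) :
  (x^T *m (A - a *: B) *m x) 0 0 =
  (x^T *m A *m x) 0 0 - a * (x^T *m B *m x) 0 0.
Proof.
rewrite mulmxBr mulmxBl -scalemxAr -scalemxAl.
by move: (_ *m A *m _) (_ *m B *m _) => P Q; rewrite !mxE.
Qed.

(** The centering matrix subtracts the mean [mu]; the deviations sum to 0, so the factor [y i 0] may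
    be replaced by [y i 0 - mu]. *)
Lemma centering_formE (R : realType) m (y : 'cV[R]_m) :
  (y^T *m centering R m *m y) 0 0 =
  \sum_i (y i 0 - (\sum_j y j 0) / m%:R) ^+ 2.
Proof.
rewrite mulmx_formE; set S := \sum_j y j 0; set mu := S / m%:R.
have rowE i : \sum_j centering R m i j * y j 0 = y i 0 - mu.
  rewrite (eq_bigr (fun j => (i == j)%:R * y j 0 - m%:R^-1 * y j 0)).
    rewrite sumrB -mulr_sumr [m%:R^-1 * _]mulrC (bigD1 i) //= eqxx mul1r.
    rewrite big1 ?addr0 //.
    by move=> j /negPf; rewrite eq_sym => ->; rewrite mul0r.
  by move=> j _; rewrite !mxE big_ord1 !mxE !mulr1 mulrBl.
under eq_bigr do rewrite rowE.
have Smu : m%:R * mu = S.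
  (* For [m = 0] the division by [m] is by zero, but the sum [S] is empty. *)
  have [m0|m0] := eqVneq m 0%N; last by rewrite mulrC divfK // pnatr_eq0.
  rewrite {1}m0 mul0r /S; case: (m) y m0 {rowE mu S} => // y _.
  by rewrite big_ord0.
under [RHS]eq_bigr => i _ do rewrite expr2 mulrBl.
rewrite sumrB -[LHS]subr0; congr (_ - _).
by rewrite -mulr_sumr sumrB sumr_const card_ord -mulr_natl Smu subrr mulr0.
Qed.

(** Covering gives every vertex a label, disjointness makes it unique, and nonempty blocks make the
    labelling surjective. *)
Lemma block_partition_index n k (C : 'I_k -> {set 'I_n}) : block_partition C ->
  exists c : 'I_n -> 'I_k,
    (forall a j, (a \in C j) = (c a == j)) /\ (forall j, exists a, c a = j).
Proof.
case=> C0 Cdisj Ccov.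
have ex a : exists j, a \in C j.
  have : a \in \bigcup_j C j by rewrite Ccov inE.
  by case/bigcupP=> j _ aj; exists j.
exists (fun a => xchoose (ex a)).
have inC a j : (a \in C j) = (xchoose (ex a) == j).
  have aC := xchooseP (ex a).
  apply/idP/eqP => [aj|<- //]; apply/eqP; apply: contraT => /Cdisj.
  by move/setP/(_ a); rewrite !inE aC aj.
split=> // j; have /set0Pn[a] := C0 j; rewrite inC => /eqP aj.
by exists a.
Qed.

(** * Block structure and spectral gap of a feasible matrix *)

Section Feasible.
Variables (R : realType) (n k : nat).
Variables (C : 'I_k -> {set 'I_n}) (c : 'I_n -> 'I_k).
Hypothesis inC : forall a j, (a \in C j) = (c a == j).
Hypothesis c_surj : forall j, exists a, c a = j.
Variables (eps : R) (M : 'M[R]_n).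
Hypothesis eps_gt0 : 0 < eps.
Hypothesis feasM : feasible C eps M.

Lemma feasible_mul_indvec j : M *m indvec R C j = 0.
Proof.
have [MU _ _ _] := feasM.
apply/colP => a; have /matrixP/(_ a j) := MU; rewrite !mxE => e0.
by rewrite -[RHS]e0; apply: eq_bigr => b _; rewrite !mxE.
Qed.

Lemma feasible_sum_block a j : \sum_(b in C j) M a b = 0.
Proof.
have /colP/(_ a) := feasible_mul_indvec j; rewrite !mxE => e0.
rewrite big_mkcond -[RHS]e0; apply: eq_bigr => b _.
by rewrite !mxE; case: ifP; rewrite ?mulr1 ?mulr0.
Qed.

(** The entries of row [a] over the block of [b] are all off-diagonal, hence nonpositive, and they
    sum to 0. *)
Lemma feasible_offblock a b : c a != c b -> M a b = 0.
Proof.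
have [_ _ Mle0 _] := feasM => cab; apply/eqP; rewrite -oppr_eq0.
have /eqP := feasible_sum_block a (c b).
rewrite -oppr_eq0 -sumrN psumr_eq0; last first.
  move=> d; rewrite inC oppr_ge0 => /eqP cd.
  by apply: Mle0; apply: contraNneq cab => ->; rewrite cd.
by move/allP/(_ b); rewrite mem_index_enum inC eqxx /=; apply.
Qed.

Lemma feasible_mulmx_block (x : 'cV[R]_n) a :
  (M *m x) a 0 = \sum_(b in C (c a)) M a b * x b 0.
Proof.
rewrite mxE [RHS]big_mkcond; apply: eq_bigr => b _.
rewrite inC; case: ifPn => // cab.
by rewrite feasible_offblock ?mul0r // eq_sym.
Qed.

(** The semidefinite constraint on block [j] is tested on the restriction of [x] to [C j]; there
    [M *m x] depends on that restriction only. *)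
Lemma feasible_block_form (x : 'cV[R]_n) j :
  eps * \sum_(a in C j) (x a 0 - (\sum_(b in C j) x b 0) / #|C j|%:R) ^+ 2
  <= \sum_(a in C j) x a 0 * (M *m x) a 0.
Proof.
have [_ _ _ /(_ j) [_ /(_ (\col_i x (enum_val i) 0))]] := feasM.
rewrite mulmx_formB centering_formE mulmx_formE subr_ge0.
set lhs := (X in X <= _); set rhs := (X in _ <= X).
suff -> : \sum_(a in C j) x a 0 * (M *m x) a 0 = rhs.
  suff <- : lhs = eps * \sum_(a in C j)
    (x a 0 - (\sum_(b in C j) x b 0) / #|C j|%:R) ^+ 2 by [].
  congr (_ * _); rewrite [RHS]big_enum_val; apply: eq_bigr => a _.
  rewrite mxE; congr ((_ - _ / _) ^+ 2); rewrite [RHS]big_enum_val.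
  by apply: eq_bigr => b _; rewrite mxE.
rewrite big_enum_val; apply: eq_bigr => a _; rewrite feasible_mulmx_block mxE.
have /eqP -> : c (enum_val a) == j by rewrite -inC enum_valP.
congr (_ * _); rewrite [LHS]big_enum_val.
by apply: eq_bigr => b _; rewrite !mxE.
Qed.

(** The upper bound in [feasible_block_form] is 0 here, so every deviation from the block mean
    vanishes. *)
Lemma feasible_ker_block (x : 'cV[R]_n) a b :
  M *m x = 0 -> c a = c b -> x a 0 = x b 0.
Proof.
move=> Mx0 cab; pose j := c a.
have := feasible_block_form x j.
rewrite [X in _ <= X]big1; last by move=> i _; rewrite Mx0 mxE mulr0.
rewrite pmulr_rle0 //; set mu := _ / _ => le0.
have eq0 : \sum_(a in C j) (x a 0 - mu) ^+ 2 == 0.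
  by rewrite eq_le le0 sumr_ge0 // => i _; exact: sqr_ge0.
have mean d : d \in C j -> x d 0 = mu.
  move=> dj; move: eq0; rewrite psumr_eq0; last by move=> i _; exact: sqr_ge0.
  move/allP/(_ d); rewrite mem_index_enum dj /= => /(_ isT).
  by rewrite sqrf_eq0 subr_eq0 => /eqP.
by rewrite !mean // inC -?cab /j.
Qed.

Lemma feasible_eigenvalue_ge r (x : 'cV[R]_n) :
  r != 0 -> x != 0 -> M *m x = r *: x -> eps <= r.
Proof.
(* The block is chosen to contain a nonzero entry of [x], so that its sum of squares is positive and
   can be cancelled at the end. *)
move=> r0 /cV0Pn[a xa] Mx; pose j := c a.
have [_ symM _ _] := feasM.
have sum0 : \sum_(b in C j) x b 0 = 0.
  (* Computed the other way, this product is [r] times the block sum of [x]. *)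
  have : (indvec R C j)^T *m M *m x = 0.
    by rewrite symM -trmx_mul feasible_mul_indvec trmx0 mul0mx.
  rewrite -mulmxA Mx -scalemxAr => /eqP; rewrite scaler_eq0 (negPf r0) /=.
  move/eqP/matrixP/(_ 0 0); rewrite !mxE => e0; rewrite -[RHS]e0.
  rewrite big_mkcond; apply: eq_bigr => b _; rewrite !mxE.
  by case: ifP; rewrite ?mul1r ?mul0r.
have := feasible_block_form x j; rewrite sum0 mul0r.
have -> : \sum_(b in C j) x b 0 * (M *m x) b 0 = r * \sum_(b in C j) x b 0 ^+ 2.
  by rewrite mulr_sumr Mx; apply: eq_bigr => b _; rewrite mxE mulrCA expr2.
under eq_bigr do rewrite subr0.
rewrite ler_pM2r // (bigD1 a) ?inC //= ltr_pwDl ?sumr_ge0 //.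
  by rewrite exprn_even_gt0.
by move=> b _; exact: sqr_ge0.
Qed.

(** * The graph of a feasible matrix *)

Lemma feasible_row_sum i : \sum_j M i j = 0.
Proof.
rewrite (partition_big c xpredT) //= big1 // => j _.
by rewrite -[RHS](feasible_sum_block i j); apply: eq_bigl => b; rewrite inC.
Qed.

Lemma feasible_laplacian : laplacian M.
Proof.
have [_ symM Mle0 _] := feasM.
(* The weights are the negated off-diagonal entries; zero row sums turn the diagonal of [M] into the
   degrees. *)
exists (\matrix_(i, j) (if i == j then 0 else - M i j)); split.
- by apply/matrixP => i j; rewrite !mxE eq_sym {1}symM mxE.
- by move=> i j ij; rewrite mxE (negPf ij) oppr_ge0 Mle0.
- by move=> i; rewrite mxE eqxx.
apply/matrixP => i j; rewrite !mxE.
have [<-|ij] := eqVneq i j; last by rewrite mulr0n sub0r opprK.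
rewrite mulr1n subr0 (bigD1 i) //= !mxE eqxx add0r.
have := feasible_row_sum i; rewrite (bigD1 i) //= => /eqP.
rewrite addr_eq0 => /eqP->.
by rewrite -sumrN; apply: eq_bigr => l; rewrite mxE eq_sym => /negPf->.
Qed.

Lemma feasible_connect a b : connect (adj M) a b = (c a == c b).
Proof.
have [_ symM Mle0 _] := feasM.
have adjc d e : adj M d e -> c d = c e.
  move=> /andP[_]; apply: contraTeq => /feasible_offblock->.
  by rewrite oppr0 ltxx.
apply/idP/eqP => [|cab].
  case/connectP => p; elim: p a => [a _ -> //|d p IHp a /=].
  by case/andP => /adjc-> /IHp h /h.
(* The indicator of the component of [a] lies in the kernel, hence is constant on the block of [a];
   it is 1 at [a], so also at [b]. *)
pose x : 'cV[R]_n := \col_d (connect (adj M) a d)%:R.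
have symadj : connect_sym (adj M).
  by apply: sym_connect_sym => d e; rewrite /adj eq_sym {1}symM mxE.
have Mx0 : M *m x = 0.
  (* A nonzero off-diagonal [M d e] is an edge and forces [x] to agree at [d] and [e], so [x d 0]
     factors out of the row. *)
  apply/colP => d; transitivity ((\sum_j M d j) * x d 0); last first.
    by rewrite feasible_row_sum mul0r mxE.
  rewrite mxE mulr_suml; apply: eq_bigr => e _; rewrite !mxE.
  have [<-//|de] := eqVneq d e.
  have [->|Mde] := eqVneq (M d e) 0; first by rewrite !mul0r.
  have ade : adj M d e by rewrite /adj de oppr_gt0 lt_neqAle Mde Mle0.
  by rewrite -(same_connect_r symadj (connect1 ade)).
have := feasible_ker_block Mx0 cab; rewrite !mxE connect0.
by case: connect => // /eqP; rewrite oner_eq0.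
Qed.

Lemma feasible_components : components (adj M) = [set C j | j : 'I_k].
Proof.
have cls a : [set d in [set: 'I_n] | connect (adj M) a d] = C (c a).
  by apply/setP => d; rewrite !inE feasible_connect inC eq_sym.
apply/setP => S; apply/imsetP/imsetP => [[a _ ->]|[j _ ->]].
  by exists (c a); rewrite ?cls.
by have [a <-] := c_surj j; exists a; rewrite ?cls.
Qed.

(** * Kernel and eigenvalues of a feasible matrix *)

Lemma feasible_ker_sum (x : 'cV[R]_n) : M *m x = 0 ->
  exists v : 'I_k -> R, x = \sum_j v j *: indvec R C j.
Proof.
move=> Mx0.
(* A representative of each block is chosen; the coefficient of its indicator is the value of [x]
   there. *)
have rep j : {a | c a == j}.
  by apply: sigW; have [a <-] := c_surj j; exists a.
exists (fun j => x (sval (rep j)) 0); apply/colP => a.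
rewrite summxE (bigD1 (c a)) //= big1 => [|j jca].
  rewrite !mxE inC eqxx mulr1 addr0; apply: feasible_ker_block => //.
  by case: (rep (c a)) => /= d /eqP->.
by rewrite !mxE inC eq_sym (negPf jca) mulr0.
Qed.

Lemma feasible_mxker : mxker M = <<[seq indvec R C j | j : 'I_k]>>%VS.
Proof.
apply/eqP; rewrite eqEsubv; apply/andP; split.
  apply/subvP => x; rewrite memv_ker lfunE /= => /eqP/feasible_ker_sum[v ->].
  apply: memv_suml => j _; apply/memvZ/memv_span/mapP; exists j => //.
  by rewrite mem_enum.
apply/span_subvP => x /mapP[j _ ->].
by rewrite memv_ker lfunE /= feasible_mul_indvec.
Qed.

(** [kermx] is the left kernel; by symmetry its transposed rows lie in the right kernel, so the rows
    are combinations of the [k] rows of the transpose of [indmx]. *)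
Lemma feasible_rank_ker : (\rank (kermx M) <= k)%N.
Proof.
have [_ symM _ _] := feasM.
apply: leq_trans (rank_leq_row (indmx R C)^T); apply: mxrankS.
apply/row_subP => i; set u := row i _.
have uM : u *m M = 0 by rewrite -row_mul mulmx_ker row0.
have /feasible_ker_sum[v uE] : M *m u^T = 0.
  by rewrite symM -trmx_mul uM trmx0.
apply/submxP; exists (\row_j v j); apply: trmx_inj.
rewrite uE trmx_mul trmxK; apply/colP => a; rewrite summxE mxE.
by apply: eq_bigr => j _; rewrite !mxE mulrC.
Qed.

Lemma feasible_lambda : (k < n)%N -> eps <= lambda M k.+1.
Proof.
move=> kn; have [_ symM _ _] := feasM.
have [s [sE s0]] := symmetric_char_poly_split (esym symM).
have ps := perm_eigenvalues sE.
apply: sorted_nth_ge; first exact: sorted_eigenvalues.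
  (* The list has [n] entries, so index [k] is in range and [nth] does not return its default 0. *)
  rewrite (perm_size ps); have := size_char_poly M.
  by rewrite sE size_prod_XsubC => -[->].
rewrite (seq.permP ps).
(* Nonzero eigenvalues are at least [eps], so those below [eps] are exactly the zeros. *)
suff -> : count (< eps) s = count_mem 0 s by exact: leq_trans feasible_rank_ker.
apply: eq_in_count => x xs /=; have [->|x0] := eqVneq x 0; first exact: eps_gt0.
apply/negbTE; rewrite -leNgt.
have /eigenvalueP[v vM v0] : eigenvalue M x.
  by rewrite eigenvalue_root_char sE root_prod_XsubC.
apply: (@feasible_eigenvalue_ge _ v^T) => //; first by rewrite trmx_eq0.
by rewrite symM -trmx_mul vM linearZ.
Qed.

End Feasible.

(** * Frobenius projection onto a closed, midpoint-convex set *)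

Lemma frobenius_sqr (R : realType) m n (A : 'M[R]_(m, n)) :
  frobenius A ^+ 2 = \sum_i \sum_j A i j ^+ 2.
Proof.
rewrite sqr_sqrtr // sumr_ge0 // => i _; rewrite sumr_ge0 // => j _.
exact: sqr_ge0.
Qed.

Section Projection.
Local Open Scope classical_set_scope.
Variable R : realType.

Lemma continuous_bigsum (T : topologicalType) (I : Type) (r : seq I)
    (F : I -> T -> R) :
  (forall i, continuous (F i)) -> continuous (fun x => \sum_(i <- r) F i x).
Proof.
move=> cF x; apply: cvg_big => [|i _]; last exact: cF.
exact: add_continuous.
Qed.

(** Expanded over the matrix units, [phi] is a finite sum of coordinates times constants. *)
Lemma linear_mx_continuous m n (phi : 'M[R]_(m, n) -> R) :
  (forall a A B, phi (a *: A + B) = a * phi A + phi B) -> continuous phi.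
Proof.
move=> linphi.
pose phiL := HB.pack_for {linear 'M[R]_(m, n) -> R^o} (phi : _ -> R^o)
  (GRing.isLinear.Build _ _ _ _ (phi : _ -> R^o) linphi).
have -> : phi = fun A => \sum_i \sum_j A i j * phi (delta_mx i j).
  apply/funext => A; rewrite -[phi]/(phiL : _ -> R) {1}[A]matrix_sum_delta.
  rewrite linear_sum; apply: eq_bigr => i _; rewrite linear_sum.
  by apply: eq_bigr => j _; rewrite linearZ.
apply: continuous_bigsum => i; apply: continuous_bigsum => j A.
exact: (cvgMr_tmp (@coord_continuous R m n i j A)).
Qed.

Lemma closed_linear_preimage m n (phi : 'M[R]_(m, n) -> R) (D : set R) :
  (forall a A B, phi (a *: A + B) = a * phi A + phi B) -> closed D ->
  closed [set A | D (phi A)].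
Proof.
move=> /linear_mx_continuous cphi; apply: preimage_closed => A _.
exact: cphi.
Qed.

Lemma closed_forall (T : topologicalType) (I : Type) (P : I -> set T) :
  (forall i, closed (P i)) -> closed [set x | forall i, P i x].
Proof.
move=> Pcl; rewrite (_ : mkset _ = \bigcap_(i in [set: I]) P i).
  exact: closed_bigI.
by apply/seteqP; split => x Px i; [move=> _|]; exact: Px.
Qed.

Lemma frobenius_sqr_continuous m n (L : 'M[R]_(m, n)) :
  continuous (fun A : 'M[R]_(m, n) => frobenius (A - L) ^+ 2).
Proof.
under eq_fun do rewrite frobenius_sqr.
apply: continuous_bigsum => i; apply: continuous_bigsum => j A.
under eq_fun do rewrite !mxE expr2.
have h := cvgB (@coord_continuous R m n i j A) (cvg_cst (L i j)).
exact: (cvgM (h _ _) (h _ _)).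
Qed.

Lemma vec_mx_continuous m n : continuous (@vec_mx R m n).
Proof.
move=> v /= S /nbhs_ballP[e e0 eS]; apply/nbhs_ballP; exists e => //= w [_ vw].
by apply: eS; split => // i j; rewrite !mxE.
Qed.

(** Heine-Borel for row vectors, transported along the continuous surjection [vec_mx]. *)
Lemma bounded_closed_mx_compact m n (A : set 'M[R]_(m, n)) (b : R) :
  (forall M, A M -> forall i j, `|M i j| <= b) -> closed A -> compact A.
Proof.
move=> Ab Acl.
have -> : A = vec_mx @` (vec_mx @^-1` A).
  apply/seteqP; split => [M AM|_ [v Av <-] //].
  by exists (mxvec M); rewrite /= mxvecK.
apply: continuous_compact.
  by apply: continuous_subspaceT; exact: vec_mx_continuous.
apply: bounded_closed_compact; last first.
  by apply: preimage_closed Acl => v _; exact: vec_mx_continuous.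
(* The absolute value is taken because the maximum defining the norm starts from 0, while [b] may be
   negative. *)
exists `|b|; split; first exact: num_real.
move=> b' bb' v Av /=; rewrite [leLHS]/Num.norm /= mx_normrE; apply/bigmax_leP.
split=> [|[i l] _ /=]; first exact: le_trans (normr_ge0 b) (ltW bb').
rewrite ord1; case/mxvec_indexP: l => p q.
have := Ab _ Av p q; rewrite mxE => /le_trans; apply.
exact: le_trans (ler_norm b) (ltW bb').
Qed.

(** The parallelogram law for [M - L] and [N - L], checked entrywise. *)
Lemma frobenius_midpoint m n (L M N : 'M[R]_(m, n)) :
  frobenius (2^-1 *: (M + N) - L) ^+ 2 =
  2^-1 * frobenius (M - L) ^+ 2 + 2^-1 * frobenius (N - L) ^+ 2
  - 4^-1 * frobenius (M - N) ^+ 2.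
Proof.
rewrite !frobenius_sqr !mulr_sumr -big_split -sumrB; apply: eq_bigr => i _.
rewrite !mulr_sumr -big_split -sumrB; apply: eq_bigr => j _.
by rewrite !mxE /=; field.
Qed.

Lemma frobenius_sqr_eq0 m n (M : 'M[R]_(m, n)) : frobenius M ^+ 2 <= 0 -> M = 0.
Proof.
rewrite frobenius_sqr => le0; apply/matrixP => i j; rewrite mxE; apply/eqP.
have row0 k : 0 <= \sum_l M k l ^+ 2.
  by rewrite sumr_ge0 // => l _; exact: sqr_ge0.
rewrite -sqrf_eq0 eq_le sqr_ge0 andbT; apply: le_trans le0.
rewrite (bigD1 i) //= (bigD1 j) //= -addrA lerDl addr_ge0 ?sumr_ge0 //.
by move=> l _; exact: sqr_ge0.
Qed.

(** Existence: the part [K] of [A] no farther from [L] than a given point is compact. Uniqueness: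
    the midpoint of two distinct minimizers would be strictly closer. *)
Lemma closed_convex_projection m n (A : set 'M[R]_(m, n)) (L : 'M[R]_(m, n)) :
  A !=set0 -> closed A ->
  (forall M N, A M -> A N -> A (2^-1 *: (M + N))) ->
  exists! M, A M /\
    forall N, A N -> frobenius (M - L) ^+ 2 <= frobenius (N - L) ^+ 2.
Proof.
move=> [M0 AM0] Acl Amid.
pose f (M : 'M[R]_(m, n)) := frobenius (M - L) ^+ 2.
have fc : continuous f := @frobenius_sqr_continuous _ _ L.
pose K := A `&` [set M | f M <= f M0].
have Kcl : closed K.
  apply: closedI => //; apply: (preimage_closed (D := [set x | x <= f M0])).
    by move=> M _; exact: fc.
  exact: closed_le.
have Kcomp : compact K.
  apply: (@bounded_closed_mx_compact _ _ _
    (f M0 + 1 + \sum_i \sum_j `|L i j|)) => // M [_ /= fM] i j.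
  have le_sum p q (F : 'I_p -> 'I_q -> R) k l :
      (forall i j, 0 <= F i j) -> F k l <= \sum_i \sum_j F i j.
    move=> F0; rewrite (bigD1 k) //= (bigD1 l) //= -addrA lerDl.
    by rewrite addr_ge0 ?sumr_ge0 // => i' _; rewrite sumr_ge0.
  have := le_sum _ _ _ i j (fun i j => normr_ge0 (L i j)).
  have := le_sum _ _ _ i j (fun i j => sqr_ge0 ((M - L) i j)).
  rewrite -frobenius_sqr -/(f M) !mxE => Mf LS.
  rewrite -(subrK (L i j) (M i j)) (le_trans (ler_normD _ _)) // lerD //.
  (* This yields [t <= t ^+ 2 + 1] for [t >= 0], which explains the constant [f M0 + 1] in the
     bound. *)
  have := sqr_ge0 (`|M i j - L i j| - 1).
  rewrite sqrrB expr1n mulr1 real_normK ?num_real //.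
  move: fM Mf (normr_ge0 (M i j - L i j)); set t := `|_|; lra.
have [M /set_mem[AM /= fM] Mmin] :
    exists2 M, M \in K & forall N, N \in K -> f M <= f N.
  apply: compact_EVT_min => //; first by exists M0; split => /=.
  exact: continuous_subspaceT.
have {}Mmin N : A N -> f M <= f N.
  move=> AN; have [fN|/ltW fN] := leP (f N) (f M0); last first.
    exact: (le_trans fM fN).
  by apply: Mmin; apply/mem_set; split.
exists M; split=> // N [AN Nmin]; apply/eqP; rewrite -subr_eq0; apply/eqP.
apply: frobenius_sqr_eq0; have := frobenius_midpoint L M N.
have := Mmin _ (Amid _ _ AM AN); have := Nmin _ AM; rewrite /f; lra.
Qed.
End Projection.

(** * The feasible set is closed, midpoint-convex and nonempty *)

Section FeasibleSet.
Local Open Scope classical_set_scope.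
Variables (R : realType) (n k : nat) (C : 'I_k -> {set 'I_n}) (eps : R).

(** Every constraint becomes a scalar condition on a linear functional of [M], the form in which
    closedness and midpoints are handled. *)
Lemma feasibleP (M : 'M[R]_n) : feasible C eps M <->
  [/\ forall i j, (M *m indmx R C) i j = 0,
      forall i j, M i j - M j i = 0,
      forall i j, i != j -> M i j <= 0
    & forall j (x : 'cV_#|C j|),
        eps * (x^T *m centering R #|C j| *m x) 0 0
        <= (x^T *m blockmx C M j *m x) 0 0].
Proof.
split=> [[MU symM Mle0 Mpsd]|[MU symM Mle0 Mpsd]]; split=> //.
- by move=> i j; rewrite MU mxE.
- by move=> i j; rewrite {1}symM mxE subrr.
- move=> j x; have [_ /(_ x)] := Mpsd j.
  by rewrite mulmx_formB subr_ge0.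
- by apply/matrixP => i j; rewrite MU mxE.
- by apply/matrixP => i j; rewrite mxE; apply/eqP; rewrite -subr_eq0 symM.
- move=> j; split=> [|x]; last by rewrite mulmx_formB subr_ge0.
  apply/matrixP => a b; rewrite !mxE !big_ord1 !mxE eq_sym.
  by congr (_ - _); apply/eqP; rewrite -subr_eq0 symM.
Qed.

Lemma blockmx_linear j a (A B : 'M[R]_n) :
  blockmx C (a *: A + B) j = a *: blockmx C A j + blockmx C B j.
Proof. by apply/matrixP => i l; rewrite !mxE. Qed.

Lemma block_form_linear j (x : 'cV[R]_#|C j|) a (A B : 'M[R]_n) :
  (x^T *m blockmx C (a *: A + B) j *m x) 0 0 =
  a * (x^T *m blockmx C A j *m x) 0 0 + (x^T *m blockmx C B j *m x) 0 0.
Proof.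
rewrite blockmx_linear mulmxDr mulmxDl -scalemxAr -scalemxAl.
by move: (_ *m _ *m _) (_ *m blockmx _ B _ *m _) => P Q; rewrite !mxE.
Qed.

Lemma mulmx_entry_linear (U : 'M[R]_(n, k)) i j a (A B : 'M[R]_n) :
  ((a *: A + B) *m U) i j = a * (A *m U) i j + (B *m U) i j.
Proof.
by rewrite mulmxDl -scalemxAl; move: (A *m U) (B *m U) => P Q; rewrite !mxE.
Qed.

Lemma feasible_closed : closed [set M : 'M[R]_n | feasible C eps M].
Proof.
rewrite (_ : mkset _ =
  [set M | forall i j, (M *m indmx R C) i j = 0] `&`
  [set M | forall i j, M i j - M j i = 0] `&`
  [set M | forall i j, i != j -> M i j <= 0] `&`
  [set M | forall j (x : 'cV_#|C j|),
     eps * (x^T *m centering R #|C j| *m x) 0 0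
     <= (x^T *m blockmx C M j *m x) 0 0]); last first.
  by apply/seteqP; split=> M /=; rewrite feasibleP => -[]//; case=> -[].
do 3?apply: closedI; do 2?apply: closed_forall => ?.
- apply: (closed_linear_preimage (D := [set x | x = 0])); last exact: closed_eq.
  exact: mulmx_entry_linear.
- apply: (closed_linear_preimage (D := [set x | x = 0])); last exact: closed_eq.
  by move=> a A B; rewrite !mxE; ring.
- apply: closed_forall => _.
  apply: (closed_linear_preimage (D := [set x | x <= 0])); last first.
    exact: closed_le.
  by move=> a A B; rewrite !mxE.
- apply: (closed_linear_preimage (D := [set x | _ <= x])); last first.
    exact: closed_ge.
  exact: block_form_linear.
Qed.

Lemma feasible_midpoint (M N : 'M[R]_n) :
  feasible C eps M -> feasible C eps N -> feasible C eps (2^-1 *: (M + N)).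
Proof.
move=> /feasibleP[MU symM Mle0 Mpsd] /feasibleP[NU symN Nle0 Npsd].
rewrite scalerDr; apply/feasibleP; split.
- by move=> i j; rewrite mulmx_entry_linear MU -scalemxAl mxE NU !mulr0 addr0.
- by move=> i j; have := symM i j; have := symN i j; rewrite !mxE; lra.
- by move=> i j ij; have := Mle0 i j ij; have := Nle0 i j ij; rewrite !mxE; lra.
- move=> j x; have := Mpsd j x; have := Npsd j x.
  (* The zero summand gives the scaled matrix the shape [a *: A + B]. *)
  rewrite block_form_linear -[2^-1 *: N]addr0 block_form_linear.
  rewrite (_ : blockmx C 0 j = 0) ?mulmx0 ?mul0mx; last first.
    by apply/matrixP => a b; rewrite !mxE.
  by rewrite [(0 : 'M_1) 0 0]mxE; lra.
Qed.

Lemma feasible_nonempty : 0 < eps -> block_partition C ->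
  [set M : 'M[R]_n | feasible C eps M] !=set0.
Proof.
move=> eps0 /block_partition_index[c [inC c_surj]].
pose N i : R := #|C (c i)|%:R.
have N0 i : N i != 0.
  by rewrite pnatr_eq0 -lt0n; apply/card_gt0P; exists i; rewrite inC.
(* The witness is [eps] times the block-diagonal matrix of the centering matrices. *)
exists (\matrix_(i, j) (eps * ((i == j)%:R - (c i == c j)%:R / N i))); split.
- apply/matrixP => i j; rewrite !mxE.
  under eq_bigr do rewrite !mxE inC -mulrA.
  rewrite -mulr_sumr; have [cij|cij] := eqVneq (c i) j; last first.
    rewrite big1 ?mulr0 // => b _.
    have [cb|] := eqVneq (c b) j; last by rewrite mulr0.
    have -> : (i == b) = false by apply: contraNF cij => /eqP->; rewrite cb.
    by rewrite cb (negPf cij) mul0r subr0 mul0r.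
  (* For [i] in block [j] the sum is 1 minus the block size divided by itself. *)
  rewrite (eq_bigr (fun b => (i == b)%:R - (b \in C j)%:R / N i)); last first.
    move=> b _; rewrite inC cij [j == _]eq_sym; have [cb|cb] := eqVneq (c b) j.
      by rewrite mulr1.
    have -> : (i == b) = false by apply: contraNF cb => /eqP<-; rewrite cij.
    by rewrite mulr0 mul0r subr0.
  have card_sum : \sum_b (b \in C j)%:R = #|C j|%:R :> R.
    rewrite -sum1_card natr_sum [RHS]big_mkcond.
    by apply: eq_bigr => b _; case: ifP.
  have delta_sum : \sum_b (i == b)%:R = 1 :> R.
    rewrite (bigD1 i) //= eqxx big1 ?addr0 // => b.
    by rewrite eq_sym => /negPf->.
  rewrite sumrB -mulr_suml card_sum delta_sum -cij mulfV; last exact: N0.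
  by rewrite subrr mulr0.
- apply/matrixP => i j; rewrite !mxE [j == i]eq_sym [c j == _]eq_sym /N.
  by have [->|] := eqVneq (c i) (c j); rewrite ?mul0r.
- move=> i j /negPf ij; rewrite mxE ij sub0r mulrN oppr_le0.
  by rewrite mulr_ge0 ?divr_ge0 ?ler0n // ltW.
(* The semidefinite constraint holds with equality. *)
move=> j; rewrite /loewner_ge (_ : blockmx _ _ _ = eps *: centering R #|C j|).
  by rewrite subrr; split=> [|x]; rewrite ?trmx0 // mulmx0 mul0mx mxE.
apply/matrixP => a b; rewrite !mxE big_ord1 !mxE mulr1 (inj_eq enum_val_inj).
have cE d : c (enum_val (d : 'I_#|C j|)) = j.
  by apply/eqP; rewrite -inC enum_valP.
by rewrite /N !cE eqxx mulr1 mul1r.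
Qed.

End FeasibleSet.

Theorem theorem6p1 (R : realType) (n k : nat) (L : 'M[R]_n)
    (C : 'I_k -> {set 'I_n}) (eps : R)
    (hL : laplacian L) (hC : block_partition C) (heps : 0 < eps) :
  (exists! M : 'M[R]_n, minimizer C L eps M) /\
  (forall M : 'M[R]_n, minimizer C L eps M ->
     [/\ laplacian M,
         components (adj M) = [set C j | j : 'I_k],
         mxker M = <<[seq indvec R C j | j : 'I_k]>>%VS
       & (k < n)%N -> eps <= lambda M k.+1 /\ 0 < eps]).
Proof.
split.
  apply: (@closed_convex_projection R n n [set M | feasible C eps M]%classic L).
  - exact: feasible_nonempty.
  - exact: feasible_closed.
  - exact: feasible_midpoint.
move=> M [feasM _]; have [c [inC c_surj]] := block_partition_index hC.
split.
- exact: (feasible_laplacian inC feasM).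
- exact: (feasible_components inC c_surj heps feasM).
- exact: (feasible_mxker inC c_surj heps feasM).
- by move=> kn; split=> //; exact: (feasible_lambda inC c_surj heps feasM).
Qed.
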